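(* Let $\mathcal{B}$ be a closed sub-arrangement of a set-arrangement $\mathcal{A}$ and let $\mathcal{L}$ be a Lie algebra of $\mathcal{A}$. Suppose that $\mathcal{L}$ satisfies the replacement condition and that all two-element sets in $\mathcal{A}$ are (pairwise) disjoint. Suppose also that either (i) $\mathcal{L}$ is graded by giving the generators in $X=\operatorname{supp}(\mathcal{A})$ some positive integer degrees, or (ii) there is at most one $B\in\mathcal{A}$ such that $|B|=2$ and $\operatorname{supp}(\mathcal{B})\cap B\neq\emptyset$. Then $\mathcal{L}'$ as a Lie algebra is the direct product of $\operatorname{im}(s_{\mathcal{B}}')$ and $\ker(\pi_{\mathcal{B}}')$ if $$[x,[y,z]]=0\quad\text{for all }x\in\operatorname{supp}(\mathcal{A})\setminus\operatorname{supp}(\mathcal{B})\text{ and all }y,z\in\operatorname{supp}(\mathcal{B}).$$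
   Context: Let $C$ be a commutative ring with unit. All Lie algebras are ordinary (non-super) Lie algebras over $C$; $\mathcal{F}(Y)$ denotes the free Lie algebra over $C$ on a set $Y$, and $\mathfrak{g}'=[\mathfrak{g},\mathfrak{g}]$ the derived Lie algebra. ''Direct product'' means internal direct product of Lie algebras (the two subalgebras commute and their direct sum as $C$-modules is the whole Lie algebra). A set-arrangement on a finite set $X=\{x_1,\ldots,x_n\}$, $n\ge 2$, is a set $\mathcal{A}$ of subsets of $X$ such that each set in $\mathcal{A}$ has at least two elements, two different sets in $\mathcal{A}$ have at most one element in common, and the union of all the sets in $\mathcal{A}$ is $X$. A Lie algebra $\mathcal{L}$ of the set-arrangement $\mathcal{A}$ is a quotient of $\mathcal{F}(X)$ by the ideal generated by all $[x_i,x_j]$ such that $\{x_i,x_j\}$ is not a subset of any $A\in\mathcal{A}$, together with $R=\bigcup_{A\in\mathcal{A}}R_A$, where for each $A\in\mathcal{A}$, $R_A$ is a given subset of $\mathcal{F}(A)'$. The localized Lie algebra at $A\in\mathcal{A}$ is $\mathcal{L}_A=\mathcal{F}(A)/\langle R_A\rangle$. $\mathcal{L}$ satisfies the replacement condition if for all $A\in\mathcal{A}$ with $|A|\ge 3$ and all $x\in A$ such that $x\in B$ for some $B\in\mathcal{A}$ with $B\neq A$, the derived algebra $\mathcal{L}_A'$ is contained in the Lie subalgebra of $\mathcal{L}_A$ generated by $A\setminus\{x\}$. Condition (i) means that for some assignment of positive integer degrees to the elements of $X$, the induced grading of $\mathcal{F}(X)$ descends to a grading of $\mathcal{L}$ (i.e.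 the defining ideal of $\mathcal{L}$ is homogeneous). For $\mathcal{B}\subseteq\mathcal{A}$, $\operatorname{supp}(\mathcal{B})=\bigcup_{B\in\mathcal{B}}B$ (so $\operatorname{supp}(\mathcal{A})=X$); $\mathcal{B}$ is a closed sub-arrangement of $\mathcal{A}$ if $|A\cap\operatorname{supp}(\mathcal{B})|\le 1$ for all $A\in\mathcal{A}\setminus\mathcal{B}$. For a closed sub-arrangement $\mathcal{B}$, the localized Lie algebra at $\mathcal{B}$ is $\mathcal{L}_{\mathcal{B}}=\mathcal{F}(\operatorname{supp}(\mathcal{B}))/\langle R_{\mathcal{B}}\rangle$, where $$R_{\mathcal{B}}=\bigcup_{B\in\mathcal{B}}R_B\cup\{[x,y]:\ x,y\in\operatorname{supp}(\mathcal{B})\text{ and } \{x,y\}\not\subseteq B \text{ for all } B\in\mathcal{B}\}.$$ $s_{\mathcal{B}}:\mathcal{L}_{\mathcal{B}}\to\mathcal{L}$ is the natural (well-defined) Lie algebra morphism sending each generator to itself, and $\pi_{\mathcal{B}}:\mathcal{L}\to\mathcal{L}_{\mathcal{B}}$ is the (well-defined) Lie algebra morphism sending all generators not in $\operatorname{supp}(\mathcal{B})$ to zero and each generator in $\operatorname{supp}(\mathcal{B})$ to itself. $s_{\mathcal{B}}':\mathcal{L}_{\mathcal{B}}'\to\mathcal{L}'$ and $\pi_{\mathcal{B}}':\mathcal{L}'\to\mathcal{L}_{\mathcal{B}}'$ are their restrictions to derived algebras. *)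

(* Defs.v *)
From HB Require Import structures.
From mathcomp Require Import all_boot all_order all_algebra.
From mathcomp Require Import boolp classical_sets.

Set Implicit Arguments.
Unset Strict Implicit.
Unset Printing Implicit Defensive.

Import GRing.Theory.

Local Open Scope ring_scope.
Local Open Scope quotient_scope.

HB.mixin Record Lmodule_isLieAlgebra (C : comPzRingType) (L : Type)
    of GRing.Lmodule C L := {
  lieb : L -> L -> L;
  liebDl : forall x y z, lieb (x + y) z = lieb x z + lieb y z;
  liebDr : forall x y z, lieb x (y + z) = lieb x y + lieb x z;
  liebZl : forall a x y, lieb (a *: x) y = a *: lieb x y;
  liebZr : forall a x y, lieb x (a *: y) = a *: lieb x y;
  liebxx : forall x, lieb x x = 0;
  lieb_jacobi : forall x y z,
    lieb x (lieb y z) + lieb y (lieb z x) + lieb z (lieb x y) = 0 }.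

#[short(type="lieAlgType")]
HB.structure Definition LieAlgebra (C : comPzRingType) :=
  {L of Lmodule_isLieAlgebra C L & GRing.Lmodule C L}.

Notation "[ 'lie' x , y ]" := (lieb x y)
  (at level 0, x, y at level 99, format "[ 'lie'  x ,  y ]") : ring_scope.

Section LieTheory.
Variables (C : comPzRingType) (L : lieAlgType C).
Implicit Types (x y z : L) (P S : set L).

Lemma lieb0l x : [lie 0, x] = 0.
Proof. by have := liebZl 0 0 x; rewrite !scale0r. Qed.

Lemma lieb0r x : [lie x, 0] = 0.
Proof. by have := liebZr 0 x 0; rewrite !scale0r. Qed.

Lemma liebNl x y : [lie - x, y] = - [lie x, y].
Proof. by rewrite -scaleN1r liebZl scaleN1r. Qed.

Lemma liebNr x y : [lie x, - y] = - [lie x, y].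
Proof. by rewrite -scaleN1r liebZr scaleN1r. Qed.

Lemma liebBl x y z : [lie x - y, z] = [lie x, z] - [lie y, z].
Proof. by rewrite liebDl liebNl. Qed.

Lemma liebBr x y z : [lie x, y - z] = [lie x, y] - [lie x, z].
Proof. by rewrite liebDr liebNr. Qed.

Lemma liebC x y : [lie x, y] = - [lie y, x].
Proof.
have := liebxx (x + y).
by rewrite liebDl !liebDr !liebxx add0r addr0 => /eqP; rewrite addr_eq0 => /eqP.
Qed.

Definition is_submodule P := P 0 /\ forall a x y, P x -> P y -> P (a *: x + y).

Definition is_lie_subalgebra P :=
  is_submodule P /\ forall x y, P x -> P y -> P [lie x, y].

Inductive lie_span S : L -> Prop :=
  | span_gen x : S x -> lie_span S x
  | span0 : lie_span S 0
  | spanZD a x y : lie_span S x -> lie_span S y -> lie_span S (a *: x + y).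

Inductive lie_subalgebra S : L -> Prop :=
  | subalgebra_gen x : S x -> lie_subalgebra S x
  | subalgebra0 : lie_subalgebra S 0
  | subalgebraZD a x y : lie_subalgebra S x -> lie_subalgebra S y ->
      lie_subalgebra S (a *: x + y)
  | subalgebra_br x y : lie_subalgebra S x -> lie_subalgebra S y ->
      lie_subalgebra S [lie x, y].

Inductive lie_ideal S : L -> Prop :=
  | ideal_gen x : S x -> lie_ideal S x
  | ideal0 : lie_ideal S 0
  | idealZD a x y : lie_ideal S x -> lie_ideal S y -> lie_ideal S (a *: x + y)
  | ideal_br x y : lie_ideal S y -> lie_ideal S [lie x, y].

Definition derived : set L :=
  lie_span (fun u : L => exists x y, u = [lie x, y]).

Definition is_lie_direct_product (D P Q : set L) :=
  [/\ is_lie_subalgebra P, is_lie_subalgebra Q,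
      forall p q, P p -> Q q -> [lie p, q] = 0,
      forall u, P u -> Q u -> u = 0
    & forall u, D u <-> exists p q, [/\ P p, Q q & u = p + q]].

Lemma lie_idealZ S a x : lie_ideal S x -> lie_ideal S (a *: x).
Proof.
by move=> Sx; rewrite -[_ *: _]addr0; apply: (idealZD a Sx (ideal0 S)).
Qed.

Lemma lie_idealD S x y : lie_ideal S x -> lie_ideal S y -> lie_ideal S (x + y).
Proof. by move=> Sx Sy; rewrite -[x]scale1r; apply: idealZD. Qed.

Lemma lie_ideall S x y : lie_ideal S x -> lie_ideal S [lie x, y].
Proof.
by move=> Sx; rewrite liebC -scaleN1r; apply/lie_idealZ/ideal_br.
Qed.

End LieTheory.

Arguments derived {C} L.

Definition lie_hom (C : comPzRingType) (L M : lieAlgType C) (f : L -> M) :=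
  linear f /\ {morph f : x y / [lie x, y] >-> [lie x, y]}.

Definition im_derived (C : comPzRingType) (L M : lieAlgType C) (f : L -> M) :
    set M :=
  fun v => exists2 u, derived L u & v = f u.

Definition ker_derived (C : comPzRingType) (L M : lieAlgType C) (f : L -> M) :
    set L :=
  fun u => derived L u /\ f u = 0.

Section LieHom.
Variables (C : comPzRingType) (L M : lieAlgType C) (f : L -> M).
Hypothesis fP : lie_hom f.

Lemma lie_homZD a x y : f (a *: x + y) = a *: f x + f y.
Proof. exact: fP.1. Qed.

Lemma lie_hom0 : f 0 = 0.
Proof.
by have := lie_homZD (-1) 0 0; rewrite scaler0 add0r scaleN1r addNr.
Qed.

Lemma lie_homD x y : f (x + y) = f x + f y.
Proof. by rewrite -[x in LHS]scale1r lie_homZD scale1r. Qed.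

Lemma lie_homZ a x : f (a *: x) = a *: f x.
Proof. by rewrite -[_ *: _ in LHS]addr0 lie_homZD lie_hom0 addr0. Qed.

Lemma lie_homN x : f (- x) = - f x.
Proof. by rewrite -scaleN1r lie_homZ scaleN1r. Qed.

Lemma lie_hom_br x y : f [lie x, y] = [lie f x, f y].
Proof. exact: fP.2. Qed.

Lemma lie_ideal_ker S : (forall u, S u -> f u = 0) ->
  forall u, lie_ideal S u -> f u = 0.
Proof.
move=> fS u; elim=> {u} [u /fS //||a x y _ x0 _ y0|x y _ y0].
- exact: lie_hom0.
- by rewrite lie_homZD x0 y0 scaler0 addr0.
- by rewrite lie_hom_br y0 lieb0r.
Qed.

Lemma derived_ker : (forall x y, [lie f x, f y] = 0) ->
  forall u, derived L u -> f u = 0.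
Proof.
move=> f0 u; elim=> {u} [_ [x [y ->]]||a x y _ x0 _ y0].
- by rewrite lie_hom_br.
- exact: lie_hom0.
- by rewrite lie_homZD x0 y0 scaler0 addr0.
Qed.

Lemma lie_hom_derived u : derived L u -> derived M (f u).
Proof.
elim=> {u} [_ [x [y ->]]||a x y _ Mx _ My].
- by rewrite lie_hom_br; apply: span_gen; exists (f x), (f y).
- by rewrite lie_hom0; apply: span0.
- by rewrite lie_homZD; apply: spanZD.
Qed.

End LieHom.

Lemma lie_hom_comp (C : comPzRingType) (L M N : lieAlgType C)
    (f : L -> M) (g : M -> N) : lie_hom f -> lie_hom g -> lie_hom (g \o f).
Proof.
move=> fP gP; split=> [a x y|x y] /=.
  by rewrite (lie_homZD fP) (lie_homZD gP).
by rewrite (lie_hom_br fP) (lie_hom_br gP).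
Qed.

Section LieQuotient.
Variables (C : comPzRingType) (L : lieAlgType C) (S : set L).

Definition lie_ideal_mem : pred L := fun x => `[< lie_ideal S x >].

Lemma lie_ideal_zmod_closed : zmod_closed lie_ideal_mem.
Proof.
split=> [|x y]; rewrite !unfold_in; first exact/asboolP/ideal0.
move=> /asboolP Sx /asboolP Sy; apply/asboolP.
by rewrite addrC -scaleN1r; apply: idealZD.
Qed.

HB.instance Definition _ :=
  GRing.isZmodClosed.Build L lie_ideal_mem lie_ideal_zmod_closed.

Definition lie_quot :=
  Quotient.quot (GRing.ZmodClosed.clone L lie_ideal_mem _).

HB.instance Definition _ := GRing.Zmodule.on lie_quot.

Definition lie_pi : L -> lie_quot := \pi_lie_quot.

Definition lie_quot_repr (u : lie_quot) : L := repr u.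

Lemma lie_quot_reprK : cancel lie_quot_repr lie_pi.
Proof. by move=> u; rewrite /lie_pi /lie_quot_repr reprK. Qed.

Lemma lie_piP x y : lie_pi x = lie_pi y <-> lie_ideal S (x - y).
Proof.
split=> [/eqP|Sxy]; last apply/eqP.
  by rewrite /lie_pi -Quotient.idealrBE => /asboolP.
by rewrite /lie_pi -Quotient.idealrBE; apply/asboolP.
Qed.

Lemma lie_pi_repr x : lie_ideal S (lie_quot_repr (lie_pi x) - x).
Proof. by apply/lie_piP; rewrite lie_quot_reprK. Qed.

Lemma lie_pi0 : lie_pi 0 = 0.
Proof. by rewrite /lie_pi !piE. Qed.

Lemma lie_piD x y : lie_pi (x + y) = lie_pi x + lie_pi y.
Proof. by rewrite /lie_pi !piE. Qed.

Definition lie_quot_scale a (u : lie_quot) := lie_pi (a *: lie_quot_repr u).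

Definition lie_quot_br (u v : lie_quot) :=
  lie_pi [lie lie_quot_repr u, lie_quot_repr v].

Lemma lie_quot_scaleE a x : lie_quot_scale a (lie_pi x) = lie_pi (a *: x).
Proof.
by apply/lie_piP; rewrite -scalerBr; apply/lie_idealZ/lie_pi_repr.
Qed.

Lemma lie_quot_brE x y : lie_quot_br (lie_pi x) (lie_pi y) = lie_pi [lie x, y].
Proof.
apply/lie_piP; set x' := lie_quot_repr _; set y' := lie_quot_repr _.
have -> : [lie x', y'] - [lie x, y] = [lie x' - x, y'] + [lie x, y' - y].
  by rewrite liebBl liebBr addrA subrK.
by apply: lie_idealD; [apply: lie_ideall | apply: ideal_br];
  apply: lie_pi_repr.
Qed.

Fact lie_quot_scalerA a b u :
  lie_quot_scale a (lie_quot_scale b u) = lie_quot_scale (a * b) u.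
Proof. by rewrite -[u]lie_quot_reprK !lie_quot_scaleE scalerA. Qed.

Fact lie_quot_scale1r : left_id 1 lie_quot_scale.
Proof. by move=> u; rewrite -[u]lie_quot_reprK !lie_quot_scaleE scale1r. Qed.

Fact lie_quot_scalerDr : right_distributive lie_quot_scale +%R.
Proof.
move=> a u v; rewrite -[u]lie_quot_reprK -[v]lie_quot_reprK.
by rewrite -lie_piD !lie_quot_scaleE scalerDr lie_piD.
Qed.

Fact lie_quot_scalerDl u : {morph lie_quot_scale^~ u : a b / a + b}.
Proof.
move=> a b; rewrite -[u]lie_quot_reprK.
by rewrite !lie_quot_scaleE scalerDl lie_piD.
Qed.

HB.instance Definition _ := GRing.Zmodule_isLmodule.Build C lie_quot
  lie_quot_scalerA lie_quot_scale1r lie_quot_scalerDr lie_quot_scalerDl.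

Lemma lie_piZ a x : lie_pi (a *: x) = a *: lie_pi x.
Proof. by rewrite -lie_quot_scaleE. Qed.

Fact lie_quot_brDl u v w :
  lie_quot_br (u + v) w = lie_quot_br u w + lie_quot_br v w.
Proof.
rewrite -[u]lie_quot_reprK -[v]lie_quot_reprK -[w]lie_quot_reprK.
by rewrite -lie_piD !lie_quot_brE liebDl lie_piD.
Qed.

Fact lie_quot_brDr u v w :
  lie_quot_br u (v + w) = lie_quot_br u v + lie_quot_br u w.
Proof.
rewrite -[u]lie_quot_reprK -[v]lie_quot_reprK -[w]lie_quot_reprK.
by rewrite -lie_piD !lie_quot_brE liebDr lie_piD.
Qed.

Fact lie_quot_brZl a u v : lie_quot_br (a *: u) v = a *: lie_quot_br u v.
Proof.
rewrite -[u]lie_quot_reprK -[v]lie_quot_reprK.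
by rewrite -lie_piZ !lie_quot_brE liebZl lie_piZ.
Qed.

Fact lie_quot_brZr a u v : lie_quot_br u (a *: v) = a *: lie_quot_br u v.
Proof.
rewrite -[u]lie_quot_reprK -[v]lie_quot_reprK.
by rewrite -lie_piZ !lie_quot_brE liebZr lie_piZ.
Qed.

Fact lie_quot_brxx u : lie_quot_br u u = 0.
Proof. by rewrite -[u]lie_quot_reprK lie_quot_brE liebxx lie_pi0. Qed.

Fact lie_quot_br_jacobi u v w :
  lie_quot_br u (lie_quot_br v w) + lie_quot_br v (lie_quot_br w u)
    + lie_quot_br w (lie_quot_br u v) = 0.
Proof.
rewrite -[u]lie_quot_reprK -[v]lie_quot_reprK -[w]lie_quot_reprK.
by rewrite !lie_quot_brE -!lie_piD lieb_jacobi lie_pi0.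
Qed.

HB.instance Definition _ := Lmodule_isLieAlgebra.Build C lie_quot
  lie_quot_brDl lie_quot_brDr lie_quot_brZl lie_quot_brZr
  lie_quot_brxx lie_quot_br_jacobi.

Lemma lie_pi_hom : lie_hom lie_pi.
Proof.
split=> [a x y|x y]; first by rewrite lie_piD lie_piZ.
by rewrite -lie_quot_brE.
Qed.

Lemma lie_pi_eq0 x : lie_pi x = 0 <-> lie_ideal S x.
Proof. by rewrite -lie_pi0 lie_piP subr0. Qed.

Lemma lie_pi_relator x : S x -> lie_pi x = 0.
Proof. by move=> Sx; apply/lie_pi_eq0/ideal_gen. Qed.

(* The map induced by f on the quotient; it is independent of the choice of
   representatives as soon as f is a morphism that kills S. *)
Definition lie_quot_lift (M : lieAlgType C) (f : L -> M) (u : lie_quot) : M :=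
  f (lie_quot_repr u).

Section Lift.
Variables (M : lieAlgType C) (f : L -> M).
Hypotheses (fP : lie_hom f) (fS : forall x, S x -> f x = 0).

Lemma lie_quot_liftE x : lie_quot_lift f (lie_pi x) = f x.
Proof.
apply/eqP; rewrite -subr_eq0 -(lie_homN fP) -(lie_homD fP).
by apply/eqP/(lie_ideal_ker fP fS)/(lie_pi_repr x).
Qed.

Lemma lie_quot_lift_hom : lie_hom (lie_quot_lift f).
Proof.
split=> [a u v|u v]; rewrite -[u]lie_quot_reprK -[v]lie_quot_reprK.
  by rewrite -lie_piZ -lie_piD !lie_quot_liftE (lie_homZD fP).
by rewrite -(lie_hom_br lie_pi_hom) !lie_quot_liftE (lie_hom_br fP).
Qed.

End Lift.
End LieQuotient.

Arguments lie_pi {C L} S x : simpl never.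
Arguments lie_quot_lift {C L} S {M} f u : simpl never.

(* The free Lie algebra: formal expressions in the generators modulo the
   congruence generated by the axioms of Lie algebras over C. *)

Section FreeLie.
Variables (C : comPzRingType) (Y : Type).

Inductive lie_term : Type :=
  | LGen of Y
  | LZero
  | LOpp of lie_term
  | LAdd of lie_term & lie_term
  | LScale of C & lie_term
  | LBr of lie_term & lie_term.

HB.instance Definition _ := gen_eqMixin lie_term.
HB.instance Definition _ := gen_choiceMixin lie_term.

Inductive lie_cong : lie_term -> lie_term -> Prop :=
  | cong_refl s : lie_cong s s
  | cong_sym s t : lie_cong s t -> lie_cong t s
  | cong_trans s t u : lie_cong s t -> lie_cong t u -> lie_cong s u
  | cong_opp s s' : lie_cong s s' -> lie_cong (LOpp s) (LOpp s')
  | cong_add s s' t t' :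
      lie_cong s s' -> lie_cong t t' -> lie_cong (LAdd s t) (LAdd s' t')
  | cong_scale a s s' : lie_cong s s' -> lie_cong (LScale a s) (LScale a s')
  | cong_br s s' t t' :
      lie_cong s s' -> lie_cong t t' -> lie_cong (LBr s t) (LBr s' t')
  | cong_addA s t u : lie_cong (LAdd s (LAdd t u)) (LAdd (LAdd s t) u)
  | cong_addC s t : lie_cong (LAdd s t) (LAdd t s)
  | cong_add0 s : lie_cong (LAdd LZero s) s
  | cong_addN s : lie_cong (LAdd (LOpp s) s) LZero
  | cong_scaleA a b s : lie_cong (LScale a (LScale b s)) (LScale (a * b) s)
  | cong_scale1 s : lie_cong (LScale 1 s) s
  | cong_scaleDr a s t :
      lie_cong (LScale a (LAdd s t)) (LAdd (LScale a s) (LScale a t))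
  | cong_scaleDl s a b :
      lie_cong (LScale (a + b) s) (LAdd (LScale a s) (LScale b s))
  | cong_brDl s t u : lie_cong (LBr (LAdd s t) u) (LAdd (LBr s u) (LBr t u))
  | cong_brDr s t u : lie_cong (LBr s (LAdd t u)) (LAdd (LBr s t) (LBr s u))
  | cong_brZl a s t : lie_cong (LBr (LScale a s) t) (LScale a (LBr s t))
  | cong_brZr a s t : lie_cong (LBr s (LScale a t)) (LScale a (LBr s t))
  | cong_brxx s : lie_cong (LBr s s) LZero
  | cong_jacobi s t u :
      lie_cong (LAdd (LAdd (LBr s (LBr t u)) (LBr t (LBr u s)))
                     (LBr u (LBr s t))) LZero.

Definition lie_congb (s t : lie_term) : bool := `[< lie_cong s t >].

Fact lie_congb_equiv : equiv_class_of lie_congb.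
Proof.
split=> [s|s t|t s u]; first exact/asboolP/cong_refl.
  by apply/idP/idP=> /asboolP st; apply/asboolP/cong_sym.
by move=> /asboolP st /asboolP tu; apply/asboolP/(cong_trans st tu).
Qed.

Canonical lie_congb_equivRel := EquivRelPack lie_congb_equiv.
Canonical lie_congb_encModRel := defaultEncModRel lie_congb.

Definition free_lie := {eq_quot lie_congb}.

HB.instance Definition _ := Choice.on free_lie.

Definition fl_pi : lie_term -> free_lie := \pi_free_lie.
Definition fl_repr (u : free_lie) : lie_term := repr u.

Lemma fl_reprK : cancel fl_repr fl_pi.
Proof. by move=> u; rewrite /fl_pi /fl_repr reprK. Qed.

Lemma fl_piP s t : fl_pi s = fl_pi t <-> lie_cong s t.
Proof.
split=> [/eqmodP/asboolP //|st].
by apply/eqmodP/asboolP.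
Qed.

Lemma fl_pi_repr s : lie_cong (fl_repr (fl_pi s)) s.
Proof. by apply/fl_piP; rewrite fl_reprK. Qed.

Definition fl_opp (u : free_lie) := fl_pi (LOpp (fl_repr u)).
Definition fl_add (u v : free_lie) := fl_pi (LAdd (fl_repr u) (fl_repr v)).
Definition fl_scale a (u : free_lie) := fl_pi (LScale a (fl_repr u)).
Definition fl_br (u v : free_lie) := fl_pi (LBr (fl_repr u) (fl_repr v)).

Lemma fl_oppE s : fl_opp (fl_pi s) = fl_pi (LOpp s).
Proof. exact/fl_piP/cong_opp/fl_pi_repr. Qed.

Lemma fl_addE s t : fl_add (fl_pi s) (fl_pi t) = fl_pi (LAdd s t).
Proof. by apply/fl_piP/cong_add; apply: fl_pi_repr. Qed.

Lemma fl_scaleE a s : fl_scale a (fl_pi s) = fl_pi (LScale a s).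
Proof. exact/fl_piP/cong_scale/fl_pi_repr. Qed.

Lemma fl_brE s t : fl_br (fl_pi s) (fl_pi t) = fl_pi (LBr s t).
Proof. by apply/fl_piP/cong_br; apply: fl_pi_repr. Qed.

Definition fl_E := (fl_oppE, fl_addE, fl_scaleE, fl_brE).

Fact fl_addA : associative fl_add.
Proof.
move=> u v w; rewrite -[u]fl_reprK -[v]fl_reprK -[w]fl_reprK !fl_E.
exact/fl_piP/cong_addA.
Qed.

Fact fl_addC : commutative fl_add.
Proof.
by move=> u v; rewrite -[u]fl_reprK -[v]fl_reprK !fl_E; apply/fl_piP/cong_addC.
Qed.

Fact fl_add0 : left_id (fl_pi LZero) fl_add.
Proof. by move=> u; rewrite -[u]fl_reprK !fl_E; apply/fl_piP/cong_add0. Qed.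

Fact fl_addN : left_inverse (fl_pi LZero) fl_opp fl_add.
Proof. by move=> u; rewrite -[u]fl_reprK !fl_E; apply/fl_piP/cong_addN. Qed.

HB.instance Definition _ :=
  GRing.isZmodule.Build free_lie fl_addA fl_addC fl_add0 fl_addN.

Fact fl_scalerA a b u : fl_scale a (fl_scale b u) = fl_scale (a * b) u.
Proof. by rewrite -[u]fl_reprK !fl_E; apply/fl_piP/cong_scaleA. Qed.

Fact fl_scale1r : left_id 1 fl_scale.
Proof. by move=> u; rewrite -[u]fl_reprK !fl_E; apply/fl_piP/cong_scale1. Qed.

Fact fl_scalerDr : right_distributive fl_scale +%R.
Proof.
move=> a u v; rewrite /GRing.add /= -[u]fl_reprK -[v]fl_reprK !fl_E.
exact/fl_piP/cong_scaleDr.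
Qed.

Fact fl_scalerDl u : {morph fl_scale^~ u : a b / a + b}.
Proof.
move=> a b; rewrite [RHS]/GRing.add /= -[u]fl_reprK !fl_E.
exact/fl_piP/cong_scaleDl.
Qed.

HB.instance Definition _ := GRing.Zmodule_isLmodule.Build C free_lie
  fl_scalerA fl_scale1r fl_scalerDr fl_scalerDl.

Lemma fl_piD s t : fl_pi (LAdd s t) = fl_pi s + fl_pi t.
Proof. by rewrite -fl_addE. Qed.

Lemma fl_piN s : fl_pi (LOpp s) = - fl_pi s.
Proof. by rewrite -fl_oppE. Qed.

Lemma fl_pi0 : fl_pi LZero = 0.
Proof. by []. Qed.

Lemma fl_piZ a s : fl_pi (LScale a s) = a *: fl_pi s.
Proof. by rewrite -fl_scaleE. Qed.

Fact fl_brDl u v w : fl_br (u + v) w = fl_br u w + fl_br v w.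
Proof.
rewrite -[u]fl_reprK -[v]fl_reprK -[w]fl_reprK -fl_piD !fl_brE -fl_piD.
exact/fl_piP/cong_brDl.
Qed.

Fact fl_brDr u v w : fl_br u (v + w) = fl_br u v + fl_br u w.
Proof.
rewrite -[u]fl_reprK -[v]fl_reprK -[w]fl_reprK -fl_piD !fl_brE -fl_piD.
exact/fl_piP/cong_brDr.
Qed.

Fact fl_brZl a u v : fl_br (a *: u) v = a *: fl_br u v.
Proof.
rewrite -[u]fl_reprK -[v]fl_reprK -fl_piZ !fl_brE -fl_piZ.
exact/fl_piP/cong_brZl.
Qed.

Fact fl_brZr a u v : fl_br u (a *: v) = a *: fl_br u v.
Proof.
rewrite -[u]fl_reprK -[v]fl_reprK -fl_piZ !fl_brE -fl_piZ.
exact/fl_piP/cong_brZr.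
Qed.

Fact fl_brxx u : fl_br u u = 0.
Proof. by rewrite -[u]fl_reprK !fl_brE; apply/fl_piP/cong_brxx. Qed.

Fact fl_jacobi u v w :
  fl_br u (fl_br v w) + fl_br v (fl_br w u) + fl_br w (fl_br u v) = 0.
Proof.
rewrite -[u]fl_reprK -[v]fl_reprK -[w]fl_reprK !fl_brE -!fl_piD.
exact/fl_piP/cong_jacobi.
Qed.

HB.instance Definition _ := Lmodule_isLieAlgebra.Build C free_lie
  fl_brDl fl_brDr fl_brZl fl_brZr fl_brxx fl_jacobi.

Lemma fl_piB s t : fl_pi (LBr s t) = [lie fl_pi s, fl_pi t].
Proof. by rewrite -fl_brE. Qed.

Definition free_gen (y : Y) : free_lie := fl_pi (LGen y).

Lemma free_lie_ind (P : free_lie -> Prop) :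
  (forall y, P (free_gen y)) -> P 0 ->
  (forall u v, P u -> P v -> P (u + v)) ->
  (forall a u, P u -> P (a *: u)) ->
  (forall u v, P u -> P v -> P [lie u, v]) ->
  forall u, P u.
Proof.
move=> Pg P0 PD PZ PB u; rewrite -[u]fl_reprK.
elim: (fl_repr u) => {u} [y||s Ps|s Ps t Pt|a s Ps|s Ps t Pt].
- exact: Pg.
- by rewrite fl_pi0.
- by rewrite fl_piN -scaleN1r; apply: PZ.
- by rewrite fl_piD; apply: PD.
- by rewrite fl_piZ; apply: PZ.
- by rewrite fl_piB; apply: PB.
Qed.

Section Lift.
Variables (M : lieAlgType C) (f : Y -> M).

Fixpoint lie_eval (s : lie_term) : M :=
  match s with
  | LGen y => f y
  | LZero => 0
  | LOpp s => - lie_eval s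
  | LAdd s t => lie_eval s + lie_eval t
  | LScale a s => a *: lie_eval s
  | LBr s t => [lie lie_eval s, lie_eval t]
  end.

Lemma lie_eval_cong s t : lie_cong s t -> lie_eval s = lie_eval t.
Proof.
elim=> //=; try by move=> *; congruence.
- by move=> *; rewrite addrA.
- by move=> *; rewrite addrC.
- by move=> *; rewrite add0r.
- by move=> *; rewrite addNr.
- by move=> *; rewrite scalerA.
- by move=> *; rewrite scale1r.
- by move=> *; rewrite scalerDr.
- by move=> *; rewrite scalerDl.
- by move=> *; rewrite liebDl.
- by move=> *; rewrite liebDr.
- by move=> *; rewrite liebZl.
- by move=> *; rewrite liebZr.
- by move=> *; rewrite liebxx.
- by move=> *; rewrite lieb_jacobi.
Qed.

Definition free_lift (u : free_lie) : M := lie_eval (fl_repr u).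

Lemma free_lift_pi s : free_lift (fl_pi s) = lie_eval s.
Proof. exact/lie_eval_cong/fl_pi_repr. Qed.

Lemma free_lift_gen y : free_lift (free_gen y) = f y.
Proof. exact: free_lift_pi. Qed.

Lemma free_lift_hom : lie_hom free_lift.
Proof.
split=> [a u v|u v]; rewrite -[u]fl_reprK -[v]fl_reprK.
  by rewrite -fl_piZ -fl_piD !free_lift_pi.
by rewrite -fl_piB !free_lift_pi.
Qed.

End Lift.

Lemma free_lie_hom_ext (M : lieAlgType C) (f g : free_lie -> M) :
  lie_hom f -> lie_hom g -> (forall y, f (free_gen y) = g (free_gen y)) ->
  f =1 g.
Proof.
move=> fP gP fg; apply: free_lie_ind => [y||u v fgu fgv|a u fgu|u v fgu fgv].
- exact: fg.
- by rewrite (lie_hom0 fP) (lie_hom0 gP).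
- by rewrite (lie_homD fP) (lie_homD gP) fgu fgv.
- by rewrite (lie_homZ fP) (lie_homZ gP) fgu.
- by rewrite (lie_hom_br fP) (lie_hom_br gP) fgu fgv.
Qed.

Inductive lie_monomial (d : Y -> nat) : nat -> free_lie -> Prop :=
  | monomial_gen y : lie_monomial d (d y) (free_gen y)
  | monomial_br k l u v : lie_monomial d k u -> lie_monomial d l v ->
      lie_monomial d (k + l) [lie u, v].

Definition free_homog (d : Y -> nat) (k : nat) : set free_lie :=
  lie_span (lie_monomial d k).

Definition homogeneous_ideal (d : Y -> nat) (I : set free_lie) :=
  forall u, I u -> exists n (v : nat -> free_lie),
    (forall k, I (v k) /\ free_homog d k (v k)) /\ u = \sum_(k < n) v k.

End FreeLie.

Arguments free_gen C {Y} y : simpl never.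
Arguments free_lift {C Y M} f u : simpl never.

Definition free_map (C : comPzRingType) (Y Z : Type) (f : Y -> Z) :
    free_lie C Y -> free_lie C Z :=
  free_lift (fun y => free_gen C (f y)).

Section Arrangement.
Variables (C : comPzRingType) (X : finType).
Implicit Types (A B S : {set X}) (AA BB : {set {set X}}).

Definition supp AA : {set X} := finset.cover AA.

Definition is_set_arrangement AA :=
  [/\ (2 <= #|X|)%N,
      forall A, A \in AA -> (2 <= #|A|)%N,
      forall A B, A \in AA -> B \in AA -> A != B -> (#|A :&: B| <= 1)%N
    & supp AA = [set: X]%SET].

Definition is_closed_subarrangement AA BB :=
  BB \subset AA /\
  forall A, A \in AA -> A \notin BB -> (#|A :&: supp BB| <= 1)%N.

(* The subset A of X is used as a set of generators through the subtype
   {x : X | x \in A}. *)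
Definition sub_incl A S (AS : A \subset S) (x : {x : X | x \in A}) :
    {x : X | x \in S} :=
  exist _ (val x) (fintype.subsetP AS _ (valP x)).

(* The data (R_A) of the relators; only the values at A in the arrangement are
   relevant. *)
Definition relators := forall A : {set X}, set (free_lie C {x : X | x \in A}).
Implicit Type R : relators.

Definition relators_derived AA (R : relators) :=
  forall A, A \in AA -> forall r, R A r -> derived (free_lie C _) r.

Definition in_common_set AA (x y : X) :=
  exists2 A, A \in AA & [set x; y]%SET \subset A.

Definition arr_relators AA (R : relators) : set (free_lie C X) :=
  fun r =>
    (exists x y, ~ in_common_set AA x y /\
       r = [lie free_gen C x, free_gen C y]) \/
    (exists A, A \in AA /\
       exists2 u, R A u & r = free_map (val : {x : X | x \in A} -> X) u).

Definition arr_lie AA R : lieAlgType C := lie_quot (arr_relators AA R).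

Definition arr_gen AA R (x : X) : arr_lie AA R :=
  lie_pi (arr_relators AA R) (free_gen C x).

Definition loc_lie R A : lieAlgType C := lie_quot (R A).

Definition loc_gen R A (x : {x : X | x \in A}) : loc_lie R A :=
  lie_pi (R A) (free_gen C x).

Definition replacement_condition AA R :=
  forall A, A \in AA -> (3 <= #|A|)%N ->
  forall x, x \in A -> (exists B, [/\ B \in AA, B != A & x \in B]) ->
  forall u, derived (loc_lie R A) u ->
    lie_subalgebra (fun v : loc_lie R A =>
      exists2 y : {y : X | y \in A}, val y != x & v = loc_gen R y) u.

Definition graded_by_generators AA R :=
  exists d : X -> nat, (forall x, (0 < d x)%N) /\
    homogeneous_ideal d (lie_ideal (arr_relators AA R)).

Lemma sub_supp BB B : B \in BB -> B \subset supp BB.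
Proof. exact: finset.bigcup_sup. Qed.

Definition locB_relators BB (R : relators) :
    set (free_lie C {x : X | x \in supp BB}) :=
  fun r =>
    (exists B (BBB : B \in BB),
       exists2 u, R B u & r = free_map (sub_incl (sub_supp BBB)) u) \/
    (exists x y : {x : X | x \in supp BB},
       ~ in_common_set BB (val x) (val y) /\
       r = [lie free_gen C x, free_gen C y]).

Arguments locB_relators : clear implicits.

Definition locB_lie BB R : lieAlgType C := lie_quot (locB_relators BB R).

Definition locB_gen BB R (x : {x : X | x \in supp BB}) : locB_lie BB R :=
  lie_pi (locB_relators BB R) (free_gen C x).

(* The morphism s_BB: it is well defined when BB is a closed sub-arrangement
   (locB_s_hom, locB_s_gen). *)
Definition locB_s AA BB R : locB_lie BB R -> arr_lie AA R :=
  lie_quot_lift (locB_relators BB R)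
    (free_lift (fun x : {x : X | x \in supp BB} => arr_gen AA R (val x))).

Definition locB_gen0 BB R (x : X) : locB_lie BB R :=
  oapp (locB_gen R) 0 (insub x : option {x : X | x \in supp BB}).

(* The morphism pi_BB: it is well defined when moreover each R A lies in the
   derived algebra of the free Lie algebra (locB_pi_hom, locB_pi_gen). *)
Definition locB_pi AA BB R : arr_lie AA R -> locB_lie BB R :=
  lie_quot_lift (arr_relators AA R) (free_lift (@locB_gen0 BB R)).

Arguments locB_s : clear implicits.
Arguments locB_pi : clear implicits.

Section WellDefined.
Variables (AA BB : {set {set X}}) (R : relators).
Hypotheses (BBcl : is_closed_subarrangement AA BB)
           (Rder : relators_derived AA R).

Lemma arr_gen_comm x y :
  ~ in_common_set AA x y -> [lie arr_gen AA R x, arr_gen AA R y] = 0.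
Proof.
move=> nxy; rewrite /arr_gen -(lie_hom_br (lie_pi_hom _)).
by apply: lie_pi_relator; left; exists x, y.
Qed.

Lemma locB_gen_comm (x y : {x : X | x \in supp BB}) :
  ~ in_common_set BB (val x) (val y) -> [lie locB_gen R x, locB_gen R y] = 0.
Proof.
move=> nxy; rewrite /locB_gen -(lie_hom_br (lie_pi_hom _)).
by apply: lie_pi_relator; right; exists x, y.
Qed.

Lemma locB_s_relators r : locB_relators BB R r ->
  free_lift (fun x : {x : X | x \in supp BB} => arr_gen AA R (val x)) r = 0.
Proof.
case=> [[B [BBB [u Ru ->]]]|[x [y [nxy ->]]]]; last first.
  rewrite (lie_hom_br (free_lift_hom _)) !free_lift_gen.
  have [->|xy] := eqVneq (val x) (val y); first exact: liebxx.
  apply: arr_gen_comm => -[A AAA /fintype.subsetP xyA]; have [BBA|BBnA] := boolP (A \in BB).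
    by apply: nxy; exists A => //; apply/fintype.subsetP.
  have := BBcl.2 A AAA BBnA; rewrite leqNgt => /negP; apply.
  have <- : #|[set val x; val y]%SET| = 2%N by rewrite cards2 xy.
  apply: subset_leq_card.
  apply/fintype.subsetP=> z /[dup] /xyA zA; rewrite !inE zA /=.
  by case/orP=> /eqP ->; apply: valP.
have AAB : B \in AA by apply: (fintype.subsetP BBcl.1).
have pi0 : lie_pi (arr_relators AA R) (free_map val u) = 0.
  by apply: lie_pi_relator; right; exists B; split=> //; exists u.
rewrite -pi0; move: u {Ru pi0}.
apply: (free_lie_hom_ext (f := free_lift _ \o free_map _)
                         (g := lie_pi _ \o free_map _)).
- exact: lie_hom_comp (free_lift_hom _) (free_lift_hom _).
- exact: lie_hom_comp (free_lift_hom _) (lie_pi_hom _).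
- by move=> y /=; rewrite /free_map !free_lift_gen.
Qed.

Lemma locB_s_hom : lie_hom (locB_s AA BB R).
Proof. exact: lie_quot_lift_hom (free_lift_hom _) locB_s_relators. Qed.

Lemma locB_s_gen (x : {x : X | x \in supp BB}) :
  locB_s AA BB R (locB_gen R x) = arr_gen AA R (val x).
Proof.
rewrite /locB_s (lie_quot_liftE (free_lift_hom _) locB_s_relators).
exact: free_lift_gen.
Qed.

Lemma locB_gen0_in (x : {x : X | x \in supp BB}) :
  locB_gen0 BB R (val x) = locB_gen R x.
Proof. by rewrite /locB_gen0 valK. Qed.

Lemma locB_gen0_out x : x \notin supp BB -> locB_gen0 BB R x = 0.
Proof. by move=> nx; rewrite /locB_gen0 insubN. Qed.

Lemma locB_pi_relators r : arr_relators AA R r ->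
  free_lift (@locB_gen0 BB R) r = 0.
Proof.
case=> [[x [y [nxy ->]]]|[A [AAA [u Ru ->]]]].
  rewrite (lie_hom_br (free_lift_hom _)) !free_lift_gen.
  have [xS|/locB_gen0_out ->] := boolP (x \in supp BB); last exact: lieb0l.
  have [yS|/locB_gen0_out ->] := boolP (y \in supp BB); last exact: lieb0r.
  rewrite (locB_gen0_in (exist _ x xS)) (locB_gen0_in (exist _ y yS)).
  apply: locB_gen_comm => -[B BBB xyB]; apply: nxy.
  by exists B => //; apply: (fintype.subsetP BBcl.1).
have homf := lie_hom_comp
  (free_lift_hom (fun x : {x : X | x \in A} => free_gen C (val x)))
  (free_lift_hom (@locB_gen0 BB R)).
rewrite -[LHS]/((free_lift _ \o free_map _) u).
have [BBA|BBnA] := boolP (A \in BB).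
  have pi0 :
    lie_pi (locB_relators BB R) (free_map (sub_incl (sub_supp BBA)) u) = 0.
    by apply: lie_pi_relator; left; exists A, BBA, u.
  rewrite -pi0 -[RHS]/((lie_pi _ \o free_map _) u).
  apply: (free_lie_hom_ext homf).
    exact: lie_hom_comp (free_lift_hom _) (lie_pi_hom _).
  move=> y /=; rewrite /free_map !free_lift_gen.
  by rewrite -[val y]/(val (sub_incl (sub_supp BBA) y)) locB_gen0_in.
apply: (derived_ker homf _ (Rder AAA Ru)).
suff [m mP] : exists m, forall x : {x : X | x \in A}, exists c,
    locB_gen0 BB R (val x) = c *: m.
  have ex v : exists c, (free_lift (@locB_gen0 BB R) \o
      free_lift (fun x : {x : X | x \in A} => free_gen C (val x))) v = c *: m.
    move: v; apply: free_lie_ind.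
    - by move=> x; rewrite /= !free_lift_gen; apply: mP.
    - by exists 0; rewrite scale0r (lie_hom0 homf).
    - move=> v w [c cv] [d dw]; exists (c + d).
      by rewrite (lie_homD homf) cv dw scalerDl.
    - by move=> a v [c cv]; exists (a * c); rewrite (lie_homZ homf) cv scalerA.
    - move=> v w [c cv] [d dw]; exists 0.
      by rewrite (lie_hom_br homf) cv dw liebZl liebZr liebxx !scaler0 scale0r.
  move=> v w; have [c ->] := ex v; have [d ->] := ex w.
  by rewrite liebZl liebZr liebxx !scaler0.
have [[m mA mS]|none] := pselect (exists2 m, m \in A & m \in supp BB); last first.
  exists 0 => x; exists 0; rewrite scaler0; apply: locB_gen0_out.
  by apply/negP=> xS; apply: none; exists (val x) => //; apply: valP.
exists (locB_gen0 BB R m) => x.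
have [xS|/locB_gen0_out ->] := boolP (val x \in supp BB); last first.
  by exists 0; rewrite scale0r.
exists 1; rewrite scale1r; congr locB_gen0; apply/eqP.
have := BBcl.2 A AAA BBnA; apply: contraLR => xm; rewrite -ltnNge.
have <- : #|[set val x; m]%SET| = 2%N by rewrite cards2 xm.
apply/subset_leq_card/fintype.subsetP => z; rewrite !inE.
by case/orP=> /eqP ->; rewrite ?mA ?mS ?xS ?(valP x).
Qed.

Lemma locB_pi_hom : lie_hom (locB_pi AA BB R).
Proof. exact: lie_quot_lift_hom (free_lift_hom _) locB_pi_relators. Qed.

Lemma locB_pi_gen (x : X) : locB_pi AA BB R (arr_gen AA R x) = locB_gen0 BB R x.
Proof.
rewrite /locB_pi (lie_quot_liftE (free_lift_hom _) locB_pi_relators).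
exact: free_lift_gen.
Qed.

End WellDefined.
End Arrangement.

Arguments locB_s {C X} AA BB R u.
Arguments locB_pi {C X} AA BB R u.
Arguments arr_gen {C X} AA R x.

(* Main.v *)
(* Let S = supp BB and let M be the span of the brackets [s, s'] (s, s' in S)
   and their iterated brackets with generators in S; M contains im s'. The
   point is that every generator x outside S kills M. Granting this, M is an
   ideal of L, hence so is its centraliser; the centraliser contains all x
   outside S, so it contains u - s (pi u) for every u, in particular the kernel
   of pi.
   To see that x kills M, compute [x, [z, w]] = [[x, z], w] + [z, [x, w]] and
   rewrite [x, z] by the replacement condition at z with generators outside S;
   this works unless {x, z} is a two-element member of the arrangement. In that
   case replacement at z inside the members of BB shows that M is also obtained
   by bracketing with S minus z only. In case (ii) a single z is exceptional; in
   case (i) z depends on x, and the induction is on the degree, which rewriting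
   M with other generators does not change. *)

Require Import Defs.
From HB Require Import structures.
From mathcomp Require Import all_boot all_order all_algebra.
From mathcomp Require Import boolp classical_sets functions.

Set Implicit Arguments.
Unset Strict Implicit.
Unset Printing Implicit Defensive.

Import GRing.Theory.

Local Open Scope ring_scope.

(** * Closures of a set under iterated brackets *)

Section AdClosure.
Variables (C : comPzRingType) (L : lieAlgType C).
Implicit Types (x y z u v w : L) (D G : set L).

Lemma lieb_der x y z : [lie x, [lie y, z]] = [lie [lie x, y], z] + [lie y, [lie x, z]].
Proof.
have /eqP := lieb_jacobi x y z; rewrite -addrA addr_eq0 => /eqP ->.
by rewrite opprD -liebNr -liebC -liebC addrC.
Qed.

(** [D] and [G] are kept apart so that [ad_closure_drop] can shrink the bracketing set while
    retaining all starting elements. *)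
Inductive ad_closure D G : L -> Prop :=
  | ad_closure_gen x : D x -> ad_closure D G x
  | ad_closure0 : ad_closure D G 0
  | ad_closureZD a x y :
      ad_closure D G x -> ad_closure D G y -> ad_closure D G (a *: x + y)
  | ad_closure_ad g x : G g -> ad_closure D G x -> ad_closure D G [lie g, x].

Lemma ad_closureD D G x y :
  ad_closure D G x -> ad_closure D G y -> ad_closure D G (x + y).
Proof. by move=> Dx Dy; rewrite -[x]scale1r; apply: ad_closureZD. Qed.

Lemma ad_closureZ D G a x : ad_closure D G x -> ad_closure D G (a *: x).
Proof.
by move=> Dx; rewrite -[_ *: _]addr0; apply: ad_closureZD => //; apply: ad_closure0.
Qed.

Lemma ad_closureN D G x : ad_closure D G x -> ad_closure D G (- x).
Proof. by move=> Dx; rewrite -scaleN1r; apply: ad_closureZ. Qed.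

Lemma lie_subalgebra_mono G G' : (forall x, G x -> G' x) ->
  forall x, lie_subalgebra G x -> lie_subalgebra G' x.
Proof.
move=> GG' x; elim=> {x} [x /GG'|||]; first exact: subalgebra_gen.
- exact: subalgebra0.
- by move=> *; apply: subalgebraZD.
- by move=> *; apply: subalgebra_br.
Qed.

(** [ad [x, y]] is the commutator of [ad x] and [ad y], so stability under [G] extends to the
    subalgebra it generates. *)
Lemma subalgebra_ad_closure D G u w :
  lie_subalgebra G u -> ad_closure D G w -> ad_closure D G [lie u, w].
Proof.
move=> Gu; elim: Gu w => {u} [g Gg w Dw||a x y _ IHx _ IHy w Dw|x y _ IHx _ IHy w Dw].
- exact: ad_closure_ad.
- by move=> w _; rewrite lieb0l; apply: ad_closure0.
- by rewrite liebDl liebZl; apply: ad_closureZD; [apply: IHx | apply: IHy].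
- have -> : [lie [lie x, y], w] = [lie x, [lie y, w]] - [lie y, [lie x, w]].
    by rewrite (lieb_der x y w) addrK.
  by apply: ad_closureD; [|apply: ad_closureN]; auto.
Qed.

Definition brackets G : set L :=
  fun u => exists x y, [/\ G x, G y & u = [lie x, y]].

Lemma subalgebra_br_closure G u v : lie_subalgebra G u -> lie_subalgebra G v ->
  ad_closure (brackets G) G [lie u, v].
Proof.
(* [u] stays general: for [v = [x, y]] the induction hypothesis on [y] is used with [x] in place of
   [u]. *)
move=> Gu Gv; elim: Gv u Gu => {v} [v Gv||a x y _ IHx _ IHy|x y Gx IHx Gy IHy] u Gu.
- elim: Gu => {u} [u Gu||a x y _ IHx _ IHy|x y Gx IHx Gy IHy].
  + by apply: ad_closure_gen; exists u, v.
  + by rewrite lieb0l; apply: ad_closure0.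
  + by rewrite liebDl liebZl; apply: ad_closureZD.
  have -> : [lie [lie x, y], v] = [lie x, [lie y, v]] - [lie y, [lie x, v]].
    by rewrite (lieb_der x y v) addrK.
  by apply: ad_closureD; [|apply: ad_closureN]; apply: subalgebra_ad_closure.
- by rewrite lieb0r; apply: ad_closure0.
- by rewrite liebDr liebZr; apply: ad_closureZD; [apply: IHx | apply: IHy].
- by apply: subalgebra_ad_closure => //; apply: IHy.
Qed.

(** The derivation [ad y] maps [G'] into the subalgebra generated by [G'], so moving it past [ad g]
    costs only a bracket with that subalgebra. It can thus be pushed down to the starting brackets
    and absorbed there. *)
Lemma ad_closure_drop y G G' :
    (forall g, G g -> g = y \/ G' g) -> (forall g, G' g -> G g) -> G y ->
    (forall g, G' g -> lie_subalgebra G' [lie y, g]) ->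
  forall w, ad_closure (brackets G) G w -> ad_closure (brackets G) G' w.
Proof.
move=> Gor G'G Gy yG'.
have yS g : lie_subalgebra G' g -> lie_subalgebra G' [lie y, g].
  elim=> {g} [g /yG' //||a u v _ yu _ yv|u v Gu yu Gv yv].
  - by rewrite lieb0r; apply: subalgebra0.
  - by rewrite liebDr liebZr; apply: subalgebraZD.
  - rewrite lieb_der -[[lie [lie y, u], v]]scale1r.
    by apply: subalgebraZD; apply: subalgebra_br.
have yE g : lie_subalgebra G' g -> ad_closure (brackets G) G' [lie y, g].
  elim=> {g} [g G'g||a u v _ yu _ yv|u v Gu yu Gv yv].
  (* The starting brackets still range over [G], so [[y, g]] is one of them. *)
  - by apply: ad_closure_gen; exists y, g; split=> //; apply: G'G.
  - by rewrite lieb0r; apply: ad_closure0.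
  - by rewrite liebDr liebZr; apply: ad_closureZD.
  - rewrite lieb_der; apply: ad_closureD; last exact: subalgebra_ad_closure.
    by rewrite liebC; apply/ad_closureN/subalgebra_ad_closure.
(* If exactly one of [u], [v] is [y], this is up to sign [[y, [y, g]]] with [[y, g]] in the
   subalgebra of [G'], so [yE] applies. *)
have yB u v : G u -> G v -> ad_closure (brackets G) G' [lie y, [lie u, v]].
  move=> Gu Gv; case: (Gor _ Gu) => [->|G'u]; case: (Gor _ Gv) => [->|G'v].
  - by rewrite liebxx lieb0r; apply: ad_closure0.
  - exact/yE/yG'.
  - by rewrite [[lie u, y]]liebC liebNr; apply/ad_closureN/yE/yG'.
  rewrite lieb_der; apply: ad_closureD.
    rewrite liebC; apply/ad_closureN/ad_closure_ad => //.
    by apply: ad_closure_gen; exists y, u.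
  by apply: ad_closure_ad => //; apply: ad_closure_gen; exists y, v.
have yA w : ad_closure (brackets G) G' w -> ad_closure (brackets G) G' [lie y, w].
  elim=> {w} [_ [u [v [Gu Gv ->]]]||a u v _ yu _ yv|g w G'g Gw yw].
  - exact: yB.
  - by rewrite lieb0r; apply: ad_closure0.
  - by rewrite liebDr liebZr; apply: ad_closureZD.
  - rewrite lieb_der; apply: ad_closureD; last exact: ad_closure_ad.
    by apply: subalgebra_ad_closure => //; apply: yG'.
move=> w; elim=> {w} [w Bw||a u v _ IHu _ IHv|g w Gg _ IHw].
- exact: ad_closure_gen.
- exact: ad_closure0.
- exact: ad_closureZD.
- by case: (Gor _ Gg) => [->|G'g]; [apply: yA | apply: ad_closure_ad].
Qed.

(** By the Jacobi identity, the annihilator of [w] is a subalgebra. *)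
Lemma subalgebra_annihilate G w : (forall g, G g -> [lie g, w] = 0) ->
  forall u, lie_subalgebra G u -> [lie u, w] = 0.
Proof.
move=> Gw u; elim=> {u} [u /Gw //||a u v _ uw _ vw|u v _ uw _ vw].
- exact: lieb0l.
- by rewrite liebDl liebZl uw vw scaler0 addr0.
- have := lieb_der u v w.
  by rewrite uw vw !lieb0r addr0 => <-.
Qed.

End AdClosure.

Lemma lie_hom_subalgebra (C : comPzRingType) (L M : lieAlgType C) (f : L -> M)
    (G : set L) (H : set M) : lie_hom f -> (forall g, G g -> H (f g)) ->
  forall u, lie_subalgebra G u -> lie_subalgebra H (f u).
Proof.
move=> fP GH u; elim=> {u} [u /GH||a u v _ Hu _ Hv|u v _ Hu _ Hv].
- exact: subalgebra_gen.
- by rewrite (lie_hom0 fP); apply: subalgebra0.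
- by rewrite (lie_homZD fP); apply: subalgebraZD.
- by rewrite (lie_hom_br fP); apply: subalgebra_br.
Qed.

(** * Power series over a Lie algebra *)

Lemma sum_alternating (V : zmodType) (F : nat -> nat -> V) n :
    (forall i, F i i = 0) -> (forall i j, F i j = - F j i) ->
  \sum_(i < n) \sum_(j < n) F i j = 0.
Proof.
move=> F0 FN; elim: n => [|n IHn]; first by rewrite big_ord0.
(* The new row and the new column cancel term by term. The corner vanishes by [F0]; antisymmetry
   alone would only give that its double is zero. *)
rewrite big_ord_recr /= big_ord_recr /= F0 addr0.
under eq_bigr do rewrite big_ord_recr /=.
rewrite big_split /= IHn add0r -big_split /= big1 // => i _.
by rewrite FN addNr.
Qed.

Section LieSeries.
Variables (C : comPzRingType) (L : lieAlgType C).

(* Power series in one variable t with coefficients in L: u stands for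
   the sum of the u k t^k. *)
Definition lie_series := nat -> L.
HB.instance Definition _ := GRing.Lmodule.on lie_series.
Implicit Types u v w : lie_series.

Definition series_br u v : lie_series :=
  fun k => \sum_(i < k.+1) [lie u i, v (k - i)%N].

(** A square index range with a Kronecker factor makes the convolution symmetric in its indices,
    which the alternating and Jacobi laws exploit. *)
Lemma series_brE n u v k : (k < n)%N ->
  series_br u v k = \sum_(i < n) \sum_(j < n) [lie u i, v j] *+ (i + j == k)%N.
Proof.
move=> kn; rewrite /series_br (big_ord_widen n (fun i => [lie u i, v (k - i)%N])) //.
rewrite big_mkcond; apply: eq_bigr => i _; rewrite ltnS; case: leqP => ik.
  have kin : (k - i < n)%N by apply: leq_ltn_trans kn; apply: leq_subr.
  rewrite (bigD1 (Ordinal kin)) //= subnKC // eqxx big1 ?addr0 // => j jk.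
  case: eqP => // ijk; case/eqP: jk; apply: val_inj.
  by rewrite /= -ijk addKn.
rewrite big1 // => j _; case: eqP => // ijk.
by move: ik; rewrite -ijk ltnNge leq_addr.
Qed.

Lemma series_br2E n u v w k : (k < n)%N ->
  series_br u (series_br v w) k =
  \sum_(i < n) \sum_(j < n) \sum_(l < n)
    [lie u i, [lie v j, w l]] *+ (i + j + l == k)%N.
Proof.
move=> kn; rewrite (series_brE _ _ kn); apply: eq_bigr => i _.
have hom : {morph lieb (u i) : x y / x + y} by apply: liebDr.
under eq_bigr => m _.
  rewrite (series_brE _ _ (ltn_ord m)) (big_morph _ hom (lieb0r _)).
  rewrite -sumrMnl.
  under eq_bigr => j _.
    rewrite (big_morph _ hom (lieb0r _)) -sumrMnl.
    over.
  over.
rewrite exchange_big; apply: eq_bigr => j _.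
rewrite exchange_big; apply: eq_bigr => l _ /=.
(* Only [m = j + l] contributes on the left. If it is out of range, the right side vanishes too, as
   [i + j + l >= n > k]. *)
have [jln|jln] := ltnP (j + l) n; last first.
  have -> : (i + j + l == k)%N = false.
    apply/negbTE; rewrite neq_ltn -addnA (leq_trans kn) ?orbT //.
    exact: leq_trans jln (leq_addl _ _).
  apply: big1 => m _; case: eqP => [jlm|]; last by rewrite mulr0n lieb0r mul0rn.
  by move: jln; rewrite jlm leqNgt ltn_ord.
rewrite (bigD1 (Ordinal jln)) //= eqxx mulr1n addnA big1 ?addr0 // => m mjl.
case: eqP => [jlm|]; last by rewrite mulr0n lieb0r mul0rn.
by case/eqP: mjl; apply: val_inj.
Qed.

Fact series_brDl u v w : series_br (u + v) w = series_br u w + series_br v w.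
Proof.
apply/funext => k; rewrite [RHS]/GRing.add /= /series_br -big_split /=.
by apply: eq_bigr => i _; rewrite -liebDl.
Qed.

Fact series_brDr u v w : series_br u (v + w) = series_br u v + series_br u w.
Proof.
apply/funext => k; rewrite [RHS]/GRing.add /= /series_br -big_split /=.
by apply: eq_bigr => i _; rewrite -liebDr.
Qed.

Fact series_brZl a u v : series_br (a *: u) v = a *: series_br u v.
Proof.
apply/funext => k; rewrite [RHS]/GRing.scale /= /series_br scaler_sumr.
by apply: eq_bigr => i _; rewrite -liebZl.
Qed.

Fact series_brZr a u v : series_br u (a *: v) = a *: series_br u v.
Proof.
apply/funext => k; rewrite [RHS]/GRing.scale /= /series_br scaler_sumr.
by apply: eq_bigr => i _; rewrite -liebZr.
Qed.

Fact series_brxx u : series_br u u = 0.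
Proof.
apply/funext => k; rewrite (series_brE _ _ (ltnSn k)).
apply: (sum_alternating (F := fun i j => [lie u i, u j] *+ (i + j == k)%N)).
  by move=> i; rewrite liebxx mul0rn.
by move=> i j; rewrite liebC mulNrn addnC.
Qed.

Fact series_br_jacobi u v w :
  series_br u (series_br v w) + series_br v (series_br w u)
    + series_br w (series_br u v) = 0.
Proof.
apply/funext => k; rewrite [LHS]/GRing.add /= [X in X + _]/GRing.add /=.
rewrite !(series_br2E _ _ _ (ltnSn k)).
(* Indices are renamed so that [i], [j], [l] belong to [u], [v], [w] in all three sums; the Jacobi
   identity of [L] then applies termwise. *)
rewrite [X in _ + X + _](_ : _ = \sum_(i < k.+1) \sum_(j < k.+1) \sum_(l < k.+1)
   [lie v j, [lie w l, u i]] *+ (i + j + l == k)%N); last first.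
  under eq_bigr => j _ do rewrite exchange_big /=.
  rewrite exchange_big; apply: eq_bigr => i _; apply: eq_bigr => j _.
  by apply: eq_bigr => l _; rewrite (addnC i j) addnAC.
rewrite [X in _ + _ + X](_ : _ = \sum_(i < k.+1) \sum_(j < k.+1) \sum_(l < k.+1)
   [lie w l, [lie u i, v j]] *+ (i + j + l == k)%N); last first.
  rewrite exchange_big; apply: eq_bigr => i _.
  rewrite exchange_big; apply: eq_bigr => j _.
  by apply: eq_bigr => l _; rewrite -addnA addnC.
rewrite -!big_split big1 // => i _ /=; rewrite -!big_split big1 // => j _ /=.
rewrite -!big_split big1 // => l _ /=.
by rewrite -!mulrnDl lieb_jacobi mul0rn.
Qed.

HB.instance Definition _ := Lmodule_isLieAlgebra.Build C lie_series
  series_brDl series_brDr series_brZl series_brZr series_brxx series_br_jacobi.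

Definition series_mono k (a : L) : lie_series := fun j => if j == k then a else 0.

Lemma series_mono_hom0 k : series_mono k 0 = 0.
Proof. by apply/funext => j; rewrite /series_mono if_same. Qed.

Lemma series_monoZD k c a b :
  series_mono k (c *: a + b) = c *: series_mono k a + series_mono k b.
Proof.
apply/funext => j; rewrite /series_mono [RHS]/GRing.add /=.
by rewrite [X in _ = X + _]/GRing.scale /=; case: eqP => // _; rewrite scaler0 addr0.
Qed.

Lemma series_mono_br k a v j :
  [lie series_mono k a, v] j = if (k <= j)%N then [lie a, v (j - k)%N] else 0.
Proof.
rewrite /lieb /= /series_br; case: leqP => kj; last first.
  apply: big1 => i _; rewrite /series_mono; case: eqP => [ik|_]; last exact: lieb0l.
  by move: kj; rewrite -ik ltnNge -ltnS ltn_ord.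
rewrite -ltnS in kj; rewrite (bigD1 (Ordinal kj)) //= /series_mono eqxx.
rewrite big1 ?addr0 // => i ik; case: eqP => [ik'|_]; last exact: lieb0l.
by case/eqP: ik; apply: val_inj.
Qed.

Lemma series_mono_br_mono k l a b :
  [lie series_mono k a, series_mono l b] = series_mono (k + l) [lie a, b].
Proof.
apply/funext => j; rewrite series_mono_br /series_mono.
case: leqP => kj; first by rewrite -(eqn_add2l k) subnKC //; case: eqP; rewrite ?lieb0r.
by case: eqP => // jkl; move: kj; rewrite jkl ltnNge leq_addr.
Qed.

End LieSeries.

(** * Generators, localizations and replacement in the Lie algebra of the arrangement *)

Section Arrangement.
Variables (C : comPzRingType) (X : finType).
Variables (AA BB : {set {set X}}) (R : relators C X).
Local Notation L := (arr_lie AA R).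
Local Notation gen := (arr_gen AA R).

Lemma arr_lie_ind (P : L -> Prop) :
  (forall x, P (gen x)) -> P 0 ->
  (forall u v, P u -> P v -> P (u + v)) ->
  (forall a u, P u -> P (a *: u)) ->
  (forall u v, P u -> P v -> P [lie u, v]) ->
  forall u, P u.
Proof.
move=> Pg P0 PD PZ PB u; rewrite -[u]lie_quot_reprK.
have piP := lie_pi_hom (arr_relators AA R).
elim/free_lie_ind: (lie_quot_repr u) => [x||v w Pv Pw|a v Pv|v w Pv Pw].
- exact: Pg.
- by rewrite lie_pi0.
- by rewrite lie_piD; apply: PD.
- by rewrite lie_piZ; apply: PZ.
- by rewrite (lie_hom_br piP); apply: PB.
Qed.

Lemma locB_lie_subalgebra (u : locB_lie BB R) :
  lie_subalgebra (range (@locB_gen C X BB R)) u.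
Proof.
rewrite -[u]lie_quot_reprK; have piP := lie_pi_hom (@locB_relators C X BB R).
elim/free_lie_ind: (lie_quot_repr u) => [x||v w Pv Pw|a v Pv|v w Pv Pw].
- by apply: subalgebra_gen; exists x.
- by rewrite lie_pi0; apply: subalgebra0.
- by rewrite lie_piD -[lie_pi _ v]scale1r; apply: subalgebraZD.
- rewrite lie_piZ -[_ *: _]addr0; apply: subalgebraZD => //; exact: subalgebra0.
- by rewrite (lie_hom_br piP); apply: subalgebra_br.
Qed.

Definition arr_gens (G : {set X}) : set L :=
  fun u => exists2 x, x \in G & u = gen x.

(** The natural map from the localization at [A]; it transports the replacement condition into
    [L]. *)
Definition loc_s A : loc_lie R A -> L :=
  lie_quot_lift (@R A) (free_lift (fun x : {x : X | x \in A} => gen (val x))).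

Section Localization.
Variables (A : {set X}) (AAA : A \in AA).

Lemma loc_s_relators r : @R A r ->
  free_lift (fun x : {x : X | x \in A} => gen (val x)) r = 0.
Proof.
move=> Rr.
have pi0 : lie_pi (arr_relators AA R) (free_map (val : {x | x \in A} -> X) r) = 0.
  by apply: lie_pi_relator; right; exists A; split=> //; exists r.
rewrite -pi0; move: r {Rr pi0}.
apply: (free_lie_hom_ext (g := lie_pi _ \o free_map _)).
- exact: free_lift_hom.
- exact: lie_hom_comp (free_lift_hom _) (lie_pi_hom _).
- by move=> y /=; rewrite /free_map !free_lift_gen.
Qed.

Lemma loc_s_hom : lie_hom (@loc_s A).
Proof. exact: lie_quot_lift_hom (free_lift_hom _) loc_s_relators. Qed.

Lemma loc_s_gen (x : {x : X | x \in A}) : loc_s (loc_gen R x) = gen (val x).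
Proof.
rewrite /loc_s (lie_quot_liftE (free_lift_hom _) loc_s_relators).
exact: free_lift_gen.
Qed.

Lemma replacement_gen : replacement_condition AA R -> (3 <= #|A|)%N ->
  forall B x y, B \in AA -> B != A -> x \in A -> x \in B -> y \in A ->
  lie_subalgebra (arr_gens (A :\ x)%SET) [lie gen x, gen y].
Proof.
move=> Lrepl A3 B x y BAA BA xA xB yA.
have AxB : exists B, [/\ B \in AA, B != A & x \in B] by exists B.
pose x' : {x : X | x \in A} := exist _ x xA.
pose y' : {x : X | x \in A} := exist _ y yA.
have dxy : derived (loc_lie R A) [lie loc_gen R x', loc_gen R y'].
  by apply: span_gen; exists (loc_gen R x'), (loc_gen R y').
have := Lrepl A AAA A3 x xA AxB _ dxy.
move=> /(lie_hom_subalgebra (H := arr_gens (A :\ x)%SET) loc_s_hom).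
rewrite (lie_hom_br loc_s_hom) !loc_s_gen; apply=> _ [z zx ->].
by exists (val z); rewrite ?loc_s_gen // !inE zx (valP z).
Qed.

End Localization.

(** A two-element [A] would equal [{x, z}]. This supplies the size bound that replacement
    requires. *)
Lemma common_set_size3 : is_set_arrangement AA -> forall A x z,
  A \in AA -> x \in A -> z \in A -> x != z -> [set x; z]%SET \notin AA ->
  (3 <= #|A|)%N.
Proof.
move=> [_ AA2 _ _] A x z AAA xA zA xz xzAA.
rewrite ltn_neqAle AA2 // andbT; apply: contra xzAA => A2.
suff <- : A = [set x; z]%SET by [].
apply/esym/eqP; rewrite eqEcard cards2 xz -(eqP A2) leqnn andbT.
by apply/fintype.subsetP => t; rewrite !inE => /orP[]/eqP->.
Qed.

Lemma pair_sub_card (A D : {set X}) x y : (#|A :&: D| <= 1)%N ->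
  x \in A -> y \in A -> x \in D -> y \in D -> x = y.
Proof.
move=> AD xA yA xD yD; apply/eqP; apply: contraLR AD => xy; rewrite -ltnNge.
have <- : #|[set x; y]%SET| = 2%N by rewrite cards2 xy.
by apply/subset_leq_card/fintype.subsetP => z; rewrite !inE => /orP[]/eqP->; apply/andP.
Qed.

Lemma suppP x : reflect (exists2 B, B \in BB & x \in B) (x \in supp BB).
Proof. exact: bigcupP. Qed.

(** * Rewriting brackets by replacement *)

Section Annihilation.
Hypotheses (AAarr : is_set_arrangement AA) (Rder : relators_derived AA R).
Hypotheses (BBcl : is_closed_subarrangement AA BB).
Hypothesis Lrepl : replacement_condition AA R.

Lemma common_set_or_comm x y :
  [lie gen x, gen y] = 0 \/ exists A, [/\ A \in AA, x \in A & y \in A].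
Proof.
have [[A AAA /fintype.subsetP xyA]|nxy] := pselect (in_common_set AA x y).
  by right; exists A; split=> //; apply: xyA; rewrite !inE eqxx ?orbT.
by left; apply: arr_gen_comm.
Qed.

Definition outer_killed (w : L) :=
  forall x, x \notin supp BB -> [lie gen x, w] = 0.

(* Replacement at z rewrites [x, z] in terms of generators outside the support
   of BB, all of which kill w. *)
Lemma outer_killed_ad x z w : x \notin supp BB -> z \in supp BB ->
  [set x; z]%SET \notin AA -> outer_killed w ->
  [lie gen x, [lie gen z, w]] = 0.
Proof.
move=> xS zS xzAA kw.
have xz : x != z by apply: contraNneq xS => ->.
rewrite lieb_der (kw x xS) lieb0r addr0 [[lie gen x, gen z]]liebC liebNl.
apply/eqP; rewrite oppr_eq0; apply/eqP.
have [->|[A [AAA zA xA]]] := common_set_or_comm z x; first by rewrite lieb0l.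
have ABB : A \notin BB.
  by apply: contra xS => ABB; apply/suppP; exists A.
have A3 := common_set_size3 AAarr AAA xA zA xz xzAA.
(* [z] lies both in some [B] of [BB] and in [A], which is not in [BB]; hence replacement in [A] at
   [z] is available. *)
have [B BBB zB] := suppP _ zS.
have BA : B != A by apply: contraNneq ABB => <-.
have BAA := fintype.subsetP BBcl.1 _ BBB.
apply: subalgebra_annihilate (replacement_gen AAA Lrepl A3 BAA BA zA zB xA).
move=> _ [t + ->]; rewrite !inE => /andP[tz tA]; apply: kw.
(* By closedness [A] meets the support in at most one point, and [z] is that point. *)
apply: contra tz => tS; apply/eqP.
exact: (pair_sub_card (BBcl.2 A AAA ABB)).
Qed.

(** This is the module [M] of the outline above. *)
Definition supp_closure : set L :=
  ad_closure (brackets (arr_gens (supp BB))) (arr_gens (supp BB)).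

Hypothesis disj2 : forall A B : {set X}, A \in AA -> B \in AA ->
  #|A| = 2%N -> #|B| = 2%N -> A != B -> [disjoint A & B].

(* Replacement at y applies to every member of BB containing y because y also
   belongs to {x, y}, which is not in BB. *)
Lemma supp_closure_drop x y : x \notin supp BB -> y \in supp BB ->
  [set x; y]%SET \in AA ->
  forall w, supp_closure w ->
    ad_closure (brackets (arr_gens (supp BB))) (arr_gens (supp BB :\ y)%SET) w.
Proof.
move=> xS yS xyAA; have xy : x != y by apply: contraNneq xS => ->.
apply: (@ad_closure_drop _ _ (gen y)).
- move=> _ [z zS ->]; have [->|zy] := eqVneq z y; first by left.
  by right; exists z; rewrite // !inE zy.
- by move=> _ [z + ->]; rewrite !inE => /andP[_ zS]; exists z.
- by exists y.
move=> _ [z + ->]; rewrite !inE => /andP[zy zS].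
have [->|[A [AAA yA zA]]] := common_set_or_comm y z; first exact: subalgebra0.
have ABB : A \in BB.
  have [//|ABB] := boolP (A \in BB); case/eqP: zy.
  exact: (pair_sub_card (BBcl.2 A AAA ABB)).
have Axy : [set x; y]%SET != A.
  apply: contraNneq xS => Axy; apply/suppP; exists A => //.
  by rewrite -Axy !inE eqxx.
(* A two-element [A] would be disjoint from [{x, y}], yet both contain [y]. *)
have A3 : (3 <= #|A|)%N.
  case: AAarr => _ AA2 _ _.
  rewrite ltn_neqAle AA2 // andbT; apply/negP => /eqP A2.
  have := disj2 xyAA AAA; rewrite cards2 xy -A2 => /(_ erefl erefl Axy).
  move=> /pred0P/(_ y) /=; rewrite !inE eqxx orbT /=.
  by move: yA => ->.
have yxy : y \in [set x; y]%SET by rewrite !inE eqxx orbT.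
have := replacement_gen AAA Lrepl A3 xyAA Axy yA yxy zA.
apply: lie_subalgebra_mono => _ [t + ->]; rewrite !inE => /andP[ty tA].
by exists t; rewrite // !inE ty; apply/suppP; exists A.
Qed.

(** * Outer generators annihilate the closure, under each alternative *)

Hypothesis supp_comm : forall x y z : X,
  x \notin supp BB -> y \in supp BB -> z \in supp BB ->
  [lie gen x, [lie gen y, gen z]] = 0.

Lemma outer_killed_brackets w :
  brackets (arr_gens (supp BB)) w -> outer_killed w.
Proof. by case=> _ [_ [[y yS ->] [z zS ->] ->]] x xS; apply: supp_comm. Qed.

Lemma outer_killed0 : outer_killed 0.
Proof. by move=> x _; apply: lieb0r. Qed.

Lemma outer_killedZD a v w :
  outer_killed v -> outer_killed w -> outer_killed (a *: v + w).
Proof. by move=> kv kw x xS; rewrite liebDr liebZr kv // kw // scaler0 addr0. Qed.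

(** A member [{x, y}] with [x] outside and [y] inside the support meets the support, so there is at
    most one. Once its [y] is dropped, [outer_killed_ad] applies to every remaining generator and
    every outer [x]. *)
Lemma outer_killed_unique_pair :
  (forall A B : {set X}, A \in AA -> B \in AA -> #|A| = 2%N -> #|B| = 2%N ->
     ~~ [disjoint supp BB & A] -> ~~ [disjoint supp BB & B] -> A = B) ->
  forall w, supp_closure w -> outer_killed w.
Proof.
move=> uniq2.
have meet x y : y \in supp BB -> ~~ [disjoint supp BB & [set x; y]%SET].
  by move=> yS; apply/pred0Pn; exists y; rewrite /= yS !inE eqxx orbT.
have ind (G : {set X}) : (forall x z, x \notin supp BB -> z \in G ->
      z \in supp BB /\ [set x; z]%SET \notin AA) ->
    forall w, ad_closure (brackets (arr_gens (supp BB))) (arr_gens G) w ->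
    outer_killed w.
  move=> GP w; elim=> {w} [w /outer_killed_brackets //||a v w _ kv _ kw|_ w [z zG ->] _ kw x xS].
  - exact: outer_killed0.
  - exact: outer_killedZD.
  - by have [zS xzAA] := GP x z xS zG; apply: outer_killed_ad.
have [[x [y [xS yS xyAA]]]|none] :=
    pselect (exists x y, [/\ x \notin supp BB, y \in supp BB & [set x; y]%SET \in AA]).
  move=> w /(supp_closure_drop xS yS xyAA); apply: ind => x' z x'S.
  rewrite !inE => /andP[zy zS]; split=> //; apply/negP=> x'zAA.
  have x'z : x' != z by apply: contraNneq x'S => ->.
  have xy : x != y by apply: contraNneq xS => ->.
  have eqxy : [set x'; z]%SET = [set x; y]%SET.
    by apply: uniq2; rewrite ?cards2 ?x'z ?xy //; apply: meet.
  have : z \in [set x; y]%SET by rewrite -eqxy !inE eqxx orbT.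
  rewrite !inE (negPf zy) orbF => /eqP zx.
  by rewrite -zx zS in xS.
move=> w; apply: ind => x z xS zS; split=> //.
by apply/negP => xzAA; apply: none; exists x, z.
Qed.

(* A grading of L by generators of degree d is encoded by the coaction
   L -> L[[t]] sending each generator x to x t^(d x). *)
Lemma grading_coaction (d : X -> nat) :
    homogeneous_ideal d (lie_ideal (arr_relators AA R)) ->
  exists phi : L -> lie_series L,
    lie_hom phi /\ forall x, phi (gen x) = series_mono (d x) (gen x).
Proof.
move=> Ihom; pose rel := arr_relators AA R.
pose phi := free_lift (fun x => series_mono (d x) (gen x)).
have phiP : lie_hom phi := free_lift_hom _.
have phi_homog k u : free_homog d k u -> phi u = series_mono k (lie_pi rel u).
  elim=> {u} [u||a u v _ IHu _ IHv].
  - elim=> {k u} [x|k l u v _ IHu _ IHv]; first by rewrite /phi free_lift_gen.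
    by rewrite (lie_hom_br phiP) IHu IHv series_mono_br_mono (lie_hom_br (lie_pi_hom rel)).
  - by rewrite (lie_hom0 phiP) lie_pi0 series_mono_hom0.
  - by rewrite (lie_homZD phiP) IHu IHv (lie_homZD (lie_pi_hom rel)) series_monoZD.
(* By homogeneity a relator is a sum of homogeneous elements of the ideal, and [phi] sends each of
   these to its class in [L], which is zero, times a power of [t]. *)
have phi0 u : rel u -> phi u = 0.
  move=> /(@ideal_gen _ _ rel) /Ihom [n [v [vP ->]]].
  rewrite (big_morph phi (lie_homD phiP) (lie_hom0 phiP)) big1 // => k _.
  have [Iv /phi_homog ->] := vP k.
  by rewrite (proj2 (lie_pi_eq0 rel (v k)) Iv) series_mono_hom0.
exists (lie_quot_lift rel phi); split; first exact: lie_quot_lift_hom.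
by move=> x; rewrite /arr_gen (lie_quot_liftE phiP phi0) /phi free_lift_gen.
Qed.

(** Strong induction on [k] shows that the coefficient [phi w k] is killed, for all [w] in the
    closure and all outer [x] at once. Bracketing with [z] shifts the index by [d z > 0], so the
    inner coefficient is already killed by every outer generator, although the way of rewriting [w]
    depends on [x]. *)
Lemma outer_killed_graded : graded_by_generators AA R ->
  forall w, supp_closure w -> outer_killed w.
Proof.
case=> d [d_gt0 /grading_coaction [phi [phiP phig]]].
have phi_br x y : phi [lie gen x, gen y] =
    series_mono (d x + d y) [lie gen x, gen y].
  by rewrite (lie_hom_br phiP) !phig series_mono_br_mono.
have comp k w : supp_closure w -> outer_killed (phi w k).
  elim/ltn_ind: k w => k IHk w Mw x xS.
  (* At most one [y] forms a pair with this [x]: two such pairs would share [x], but distinct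
     two-element members are disjoint. *)
  have Mcl : exists2 G : {set X},
      forall z, z \in G -> z \in supp BB /\ [set x; z]%SET \notin AA &
      ad_closure (brackets (arr_gens (supp BB))) (arr_gens G) w.
    have [[y [yS xyAA]]|none] :=
        pselect (exists y, y \in supp BB /\ [set x; y]%SET \in AA).
      exists (supp BB :\ y)%SET; last exact: (supp_closure_drop xS yS xyAA).
      move=> z; rewrite !inE => /andP[zy zS]; split=> //; apply/negP => xzAA.
      have xz : x != z by apply: contraNneq xS => ->.
      have xy : x != y by apply: contraNneq xS => ->.
      have xyz : [set x; z]%SET != [set x; y]%SET.
        apply: contraNneq zy => eqxz.
        have : z \in [set x; y]%SET by rewrite -eqxz !inE eqxx orbT.
        by rewrite !inE eq_sym (negPf xz).
      have := disj2 xzAA xyAA; rewrite !cards2 xz xy => /(_ erefl erefl xyz).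
      by move=> /pred0P/(_ x); rewrite /= !inE !eqxx.
    exists (supp BB) => // z zS; split=> //.
    by apply/negP => xzAA; apply: none; exists z.
  have {Mw Mcl} [G GP Gw] := Mcl.
  have sub v : ad_closure (brackets (arr_gens (supp BB))) (arr_gens G) v ->
      supp_closure v.
    elim=> {v} [v Bv||a u v _ Mu _ Mv|_ v [z zG ->] _ Mv].
    - exact: ad_closure_gen.
    - exact: ad_closure0.
    - exact: ad_closureZD.
    - by apply: ad_closure_ad => //; exists z => //; case: (GP z zG).
  elim: Gw => {w} [_ [_ [_ [[y yS ->] [z zS ->] ->]]]||a v w _ kv _ kw|_ w [z zG ->] Gw _].
  - rewrite phi_br /series_mono; case: eqP => _; last exact: lieb0r.
    exact: supp_comm.
  - by rewrite (lie_hom0 phiP) lieb0r.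
  - rewrite (lie_homZD phiP).
    have -> : (a *: phi v + phi w) k = a *: phi v k + phi w k by [].
    by rewrite liebDr liebZr kv kw scaler0 addr0.
  - rewrite (lie_hom_br phiP) phig series_mono_br.
    case: leqP => [dk|_]; last exact: lieb0r.
    have [zS xzAA] := GP z zG; apply: outer_killed_ad => //.
    apply: IHk; last exact: sub.
    by rewrite ltn_subrL d_gt0 (leq_trans (d_gt0 z) dk).
(* To return from coefficients to [w]: the closure is spanned by elements [h] with [phi h = h t^k],
   and the coefficient of index [k] of such an [h] is [h] itself. *)
have spanned w : supp_closure w ->
    lie_span (fun h => supp_closure h /\ exists k, phi h = series_mono k h) w.
  elim=> {w} [w Bw||a v w _ Hv _ Hw|_ w [z zS ->] _ Hw].
  - apply: span_gen; split; first exact: ad_closure_gen.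
    by case: Bw => _ [_ [[y _ ->] [z _ ->] ->]]; exists (d y + d z)%N.
  - exact: span0.
  - exact: spanZD.
  - elim: Hw => {w} [h [Mh [k hk]]||a v w _ Hv _ Hw].
    + apply: span_gen; split; first by apply: ad_closure_ad => //; exists z.
      by exists (d z + k)%N; rewrite (lie_hom_br phiP) phig hk series_mono_br_mono.
    + by rewrite lieb0r; apply: span0.
    + by rewrite liebDr liebZr; apply: spanZD.
move=> w /spanned; elim=> {w} [h [Mh [k hk]]||a v w _ kv _ kw].
- by have := comp k h Mh; rewrite hk /series_mono eqxx.
- exact: outer_killed0.
- exact: outer_killedZD.
Qed.

(** * The centraliser of the closure and the direct product *)

Hypothesis closure_killed : forall w, supp_closure w -> outer_killed w.

Definition commutes_closure (u : L) := forall m, supp_closure m -> [lie u, m] = 0.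

(** Inner generators preserve the closure by construction and outer ones kill it; the Jacobi
    identity extends this to all of [L]. *)
Lemma supp_closure_ideal u m : supp_closure m -> supp_closure [lie u, m].
Proof.
elim/arr_lie_ind: u m => [x||u v IHu IHv|a u IHu|u v IHu IHv] m Mm.
- have [xS|xS] := boolP (x \in supp BB).
    by apply: ad_closure_ad => //; exists x.
  by rewrite closure_killed //; apply: ad_closure0.
- by rewrite lieb0l; apply: ad_closure0.
- by rewrite liebDl; apply: ad_closureD; [apply: IHu | apply: IHv].
- by rewrite liebZl; apply: ad_closureZ; apply: IHu.
- have -> : [lie [lie u, v], m] = [lie u, [lie v, m]] - [lie v, [lie u, m]].
    by rewrite (lieb_der u v m) addrK.
  apply: ad_closureD; [|apply: ad_closureN].
    by apply: IHu; apply: IHv.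
  by apply: IHv; apply: IHu.
Qed.

(** The centraliser of an ideal is an ideal. *)
Lemma commutes_closure_ad u v : commutes_closure v -> commutes_closure [lie u, v].
Proof.
move=> cv m Mm; have := lieb_der u v m.
by rewrite (cv m Mm) (cv _ (supp_closure_ideal u Mm)) lieb0r addr0 => <-.
Qed.

Lemma commutes_closureD u v :
  commutes_closure u -> commutes_closure v -> commutes_closure (u + v).
Proof. by move=> cu cv m Mm; rewrite liebDl cu // cv // addr0. Qed.

Lemma commutes_closureZ a u : commutes_closure u -> commutes_closure (a *: u).
Proof. by move=> cu m Mm; rewrite liebZl cu // scaler0. Qed.

Local Notation s := (locB_s AA BB R).
Local Notation pi := (locB_pi AA BB R).

(** The endomorphism [s \o pi] fixes inner generators and kills outer ones, so the claim holds on
    generators; it spreads because the centraliser is an ideal. *)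
Lemma commutes_closure_sub u : commutes_closure (u - s (pi u)).
Proof.
have sP := locB_s_hom R BBcl; have piP := locB_pi_hom BBcl Rder.
elim/arr_lie_ind: u => [x||u v cu cv|a u cu|u v cu cv].
- have [xS|xS] := boolP (x \in supp BB).
    rewrite locB_pi_gen // (locB_gen0_in R (exist _ x xS)) locB_s_gen //= subrr.
    by move=> m _; apply: lieb0l.
  rewrite locB_pi_gen // locB_gen0_out // (lie_hom0 sP) subr0 => m Mm.
  exact: closure_killed.
- by rewrite (lie_hom0 piP) (lie_hom0 sP) subr0 => m _; apply: lieb0l.
- rewrite (lie_homD piP) (lie_homD sP) opprD addrACA.
  exact: commutes_closureD.
- rewrite (lie_homZ piP) (lie_homZ sP) -scalerBr.
  exact: commutes_closureZ.
- rewrite (lie_hom_br piP) (lie_hom_br sP).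
  set u' := s (pi u); set v' := s (pi v).
  (* Each summand is arranged to have an element of the centraliser as its second entry, as
     [commutes_closure_ad] expects. *)
  have -> : [lie u, v] - [lie u', v'] = - [lie v, u - u'] + [lie u', v - v'].
    by rewrite (liebC v) opprK liebBl liebBr addrA subrK.
  apply: commutes_closureD; last exact: commutes_closure_ad.
  by rewrite -scaleN1r; apply/commutes_closureZ/commutes_closure_ad.
Qed.

(** The image of [s] lies in the subalgebra generated by the inner generators, and brackets within
    it fall in the closure. *)
Lemma im_derived_closure m : im_derived s m -> supp_closure m.
Proof.
have sP := locB_s_hom R BBcl.
have sS u : lie_subalgebra (arr_gens (supp BB)) (s u).
  have := locB_lie_subalgebra u.
  apply: lie_hom_subalgebra sP _ _ => _ [x _ <-].
  by exists (val x); [apply: valP | rewrite locB_s_gen].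
move=> [u + ->]; elim=> {u} [_ [u [v ->]]||a u v _ Mu _ Mv].
- by rewrite (lie_hom_br sP); apply: subalgebra_br_closure.
- by rewrite (lie_hom0 sP); apply: ad_closure0.
- by rewrite (lie_homZD sP); apply: ad_closureZD.
Qed.

Lemma locB_sK : cancel s pi.
Proof.
have sP := locB_s_hom R BBcl; have piP := locB_pi_hom BBcl Rder.
move=> u; elim: (locB_lie_subalgebra u) => {u} [_ [x _ <-]||a u v _ IHu _ IHv|u v _ IHu _ IHv].
- by rewrite locB_s_gen // locB_pi_gen // locB_gen0_in.
- by rewrite (lie_hom0 sP) (lie_hom0 piP).
- by rewrite (lie_homZD sP) (lie_homZD piP) IHu IHv.
- by rewrite (lie_hom_br sP) (lie_hom_br piP) IHu IHv.
Qed.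

Lemma derived_direct_product :
  is_lie_direct_product (derived L) (im_derived s) (ker_derived pi).
Proof.
have sP := locB_s_hom R BBcl; have piP := locB_pi_hom BBcl Rder.
split.
- split; first split.
  + by exists 0; [apply: span0 | rewrite (lie_hom0 sP)].
  + move=> a _ _ [u du ->] [v dv ->]; exists (a *: u + v); first exact: spanZD.
    by rewrite (lie_homZD sP).
  + move=> _ _ [u du ->] [v dv ->]; exists [lie u, v].
      by apply: span_gen; exists u, v.
    by rewrite (lie_hom_br sP).
- split; first split.
  + by split; [apply: span0 | rewrite (lie_hom0 piP)].
  + move=> a u v [du u0] [dv v0]; split; first exact: spanZD.
    by rewrite (lie_homZD piP) u0 v0 scaler0 addr0.
  + move=> u v [du u0] [dv v0]; split; first by apply: span_gen; exists u, v.
    by rewrite (lie_hom_br piP) u0 lieb0l.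
(* As [pi q = 0], [q] equals [q - s (pi q)] and so centralises the closure, which contains [p]. *)
- move=> p q /im_derived_closure Mp [_ q0].
  have := commutes_closure_sub q Mp; rewrite q0 (lie_hom0 sP) subr0 => qp.
  by rewrite liebC qp oppr0.
- by move=> _ [u _ ->] [_ u0]; rewrite -[u]locB_sK u0 (lie_hom0 sP).
- move=> u; split=> [du|[_ [q [[v dv ->] [dq _] ->]]]].
  + have dp := lie_hom_derived piP du.
    exists (s (pi u)), (u - s (pi u)); split; last by rewrite addrC subrK.
      by exists (pi u).
    split; last by rewrite (lie_homD piP) (lie_homN piP) locB_sK subrr.
    rewrite -[u - _]addrC -scaleN1r; apply: spanZD => //.
    exact: lie_hom_derived.
  + by rewrite -[s v]scale1r; apply: spanZD => //; apply: lie_hom_derived.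
Qed.

End Annihilation.
End Arrangement.

Theorem proposition3p9 (C : comPzRingType) (X : finType)
    (AA BB : {set {set X}}) (R : relators C X)
    (AAarr : is_set_arrangement AA)
    (Rder : relators_derived AA R)
    (BBcl : is_closed_subarrangement AA BB)
    (Lrepl : replacement_condition AA R)
    (disj2 : forall A B : {set X}, A \in AA -> B \in AA ->
       #|A| = 2%N -> #|B| = 2%N -> A != B -> [disjoint A & B])
    (i_or_ii :
       graded_by_generators AA R \/
       (forall A B : {set X}, A \in AA -> B \in AA ->
          #|A| = 2%N -> #|B| = 2%N ->
          ~~ [disjoint supp BB & A] -> ~~ [disjoint supp BB & B] -> A = B))
    (supp_comm : forall x y z : X,
       x \in (supp AA :\: supp BB)%SET -> y \in supp BB -> z \in supp BB ->
       [lie arr_gen AA R x, [lie arr_gen AA R y, arr_gen AA R z]] = 0) :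
  is_lie_direct_product (derived (arr_lie AA R))
    (im_derived (locB_s AA BB R)) (ker_derived (locB_pi AA BB R)).
Proof.
have supp_comm' x y z : x \notin supp BB -> y \in supp BB -> z \in supp BB ->
    [lie arr_gen AA R x, [lie arr_gen AA R y, arr_gen AA R z]] = 0.
  by move=> xS; apply: supp_comm; case: AAarr => _ _ _ ->; rewrite !inE xS.
apply: derived_direct_product => //.
case: i_or_ii => [grad|uniq2].
  exact: outer_killed_graded.
exact: outer_killed_unique_pair.
Qed.
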